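(* Let $q=3^m$ with $m\ge1$, and let $\lambda_2$ denote the number of blocks in $\mathcal B_{W_7^{\mathrm{Luc}}}$ containing any fixed $3$-subset of $\mathbb P^1(\mathbb F_q)$ (this number does not depend on the $3$-subset). Then $$\lambda_2=\frac{q^2+((-1)^m-14)q+36}{24}.$$ It follows that $$|\mathcal B_{W_7^{\mathrm{Luc}}}|=\frac{q(q^2-1)\bigl(q^2+((-1)^m-14)q+36\bigr)}{5040}.$$ In particular, $\mathcal B_{W_7^{\mathrm{Luc}}}\neq\varnothing$ if and only if $\lambda_2>0$, if and only if $m\ge3$; in that case $(\mathbb P^1(\mathbb F_q),\mathcal B_{W_7^{\mathrm{Luc}}})$ is a $3$-$(q+1,7,\lambda_2)$ design.
   Context: Here the characteristic is $3$ and the Lucas subspace for $k=7$ is $$W_7^{\mathrm{Luc}}=\mathrm{span}_{\mathbb F_q}\{X^7,X^6Y,X^4Y^3,X^3Y^4,XY^6,Y^7\}\subseteq\mathbb F_q[X,Y]_7,$$ where $\mathbb F_q[X,Y]_7$ is the space of homogeneous polynomials of degree $7$ over $\mathbb F_q$. $\mathbb P^1(\mathbb F_q)=\mathbb F_q\cup\{\infty\}$. For a $7$-subset $S\subseteq\mathbb P^1(\mathbb F_q)$, $F_S(X,Y)=\prod_{t\in S}(X-tY)$, where the factor for $t=\infty$ is taken to be $Y$. The block set is $\mathcal B_{W_7^{\mathrm{Luc}}}=\{S\subseteq\mathbb P^1(\mathbb F_q): |S|=7,\ F_S\in W_7^{\mathrm{Luc}}\}$. A $t$-$(v,k,\lambda)$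 design is a pair $(P,\mathcal B)$ with $P$ a finite set, $|P|=v$, and $\mathcal B$ a set of $k$-subsets of $P$ such that every $t$-subset of $P$ is contained in exactly $\lambda$ members of $\mathcal B$. *)

(* Defs.v *)
From HB Require Import structures.
From mathcomp Require Import all_boot all_order all_algebra.
From mathcomp.multinomials Require Import mpoly.

Set Implicit Arguments.
Unset Strict Implicit.
Unset Printing Implicit Defensive.

Import GRing.Theory.
Local Open Scope ring_scope.

(* In the option type, None is the point at infinity. *)
Definition P1 (F : finFieldType) : finType := option F.

(* The variables of F[X, Y] = {mpoly F[2]}. *)
Definition varX (F : finFieldType) : {mpoly F[2]} := 'X_(ord0 : 'I_2).
Definition varY (F : finFieldType) : {mpoly F[2]} := 'X_(ord_max : 'I_2).

Definition linear_factor (F : finFieldType) (t : P1 F) : {mpoly F[2]} :=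
  if t is Some a then varX F - a *: varY F else varY F.

Definition FS (F : finFieldType) (S : {set P1 F}) : {mpoly F[2]} :=
  \prod_(t in S) linear_factor t.

Definition lucas7_monomials (F : finFieldType) : seq {mpoly F[2]} :=
  let X := varX F in let Y := varY F in
  [:: X ^+ 7; X ^+ 6 * Y; X ^+ 4 * Y ^+ 3; X ^+ 3 * Y ^+ 4; X * Y ^+ 6; Y ^+ 7].

(* indhomog 7 casts into the space dhomog 2 F 7 of forms of degree 7; it is the
   identity on such forms (indhomogK) and sends any other polynomial to 0.
   It is only applied below to forms of degree 7: see lucas7_monomials_homog
   and FS_homog. *)
Definition W7Luc (F : finFieldType) : {vspace dhomog 2 F 7} :=
  <<[seq indhomog 7 p | p <- lucas7_monomials F]>>%VS.

Definition lucas7_blocks (F : finFieldType) : {set {set P1 F}} :=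
  [set S : {set P1 F} | (#|S| == 7)%N && (indhomog 7 (FS S) \in W7Luc F)].

Definition is_design (t v k lambda : nat) (P : finType) (B : {set {set P}})
    : Prop :=
  [/\ #|P| = v,
      forall S : {set P}, S \in B -> #|S| = k
    & forall T : {set P}, #|T| = t -> #|[set S in B | T \subset S]| = lambda].

Lemma indhomogK (F : finFieldType) (d : nat) (p : {mpoly F[2]}) :
  p \is d.-homog -> mpoly_of_dhomog (indhomog d p) = p.
Proof. by move=> hp; rewrite /indhomog -[LHS]/(val _) val_insubd hp. Qed.

Lemma varX_homog (F : finFieldType) : varX F \is 1.-homog.
Proof. by rewrite dhomogX /= mdeg1. Qed.

Lemma varY_homog (F : finFieldType) : varY F \is 1.-homog.
Proof. by rewrite dhomogX /= mdeg1. Qed.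

Lemma FS_homog (F : finFieldType) (S : {set P1 F}) : FS S \is #|S|.-homog.
Proof.
rewrite /FS -sum1_card; apply: (big_ind2 (fun p d => p \is d.-homog)).
- exact: dhomog1.
- by move=> p d p' d'; exact: dhomogM.
case=> [a|] _ /=; last exact: varY_homog.
by rewrite rpredB ?rpredZ ?varX_homog ?varY_homog.
Qed.

Lemma lucas7_monomials_homog (F : finFieldType) (p : {mpoly F[2]}) :
  p \in lucas7_monomials F -> p \is 7.-homog.
Proof.
have hX n : varX F ^+ n \is n.-homog.
  by have := dhomogMn n (varX_homog F); rewrite mul1n.
have hY n : varY F ^+ n \is n.-homog.
  by have := dhomogMn n (varY_homog F); rewrite mul1n.
rewrite !inE => /orP[/eqP->|]; first exact: hX.
move=> /orP[/eqP->|]; first exact: (dhomogM (hX 6) (hY 1)).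
move=> /orP[/eqP->|]; first exact: (dhomogM (hX 4) (hY 3)).
move=> /orP[/eqP->|]; first exact: (dhomogM (hX 3) (hY 4)).
move=> /orP[/eqP->|/eqP->]; last exact: hY.
exact: (dhomogM (hX 1) (hY 6)).
Qed.

(* Main.v *)
Require Import Defs.
From HB Require Import structures.
From mathcomp Require Import all_boot all_order all_algebra all_fingroup.
From mathcomp.multinomials Require Import mpoly.
From mathcomp Require Import finfield ring zify.

(* In characteristic 3 a form of degree 7 lies in W7Luc iff its dehomogenisation f satisfies
   f'' = 0. This condition is invariant under affine maps, and the one on coefficients under
   exchanging X and Y, so that a 3-subset may be taken to be {oo, 0, 1}. The blocks containing
   it are then the 4-subsets {x1, .., x4} of F \ {0, 1} such that, with x5 = 1, the xi have sum 0
   and their inverses have sum 0. Rescaled to x1 + x2 + x3 = 1, these 5-tuples are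
   (1 - p, s - p, - s - p, 1 + y, 1 - y) with
     (p - s^2) y^2 = p ((p + 1)^2 - s^2),
   and counting y first leaves the sum over s, p of chi D for
     D = (p - s^2) p ((p + 1)^2 - s^2),
   chi being the quadratic character. Reading s and p as the sum and the product of u and v, the
   factor p ((p + 1)^2 - s^2) becomes (u^3 - u) (v^3 - v), and the sum is expressed through the
   square of the sum of the chi (u^3 - u); the latter is found by counting the points of
   u^3 - u = w^2 (v^3 - v), a surface which is unirational in characteristic 3.
   Finally, chi (-1) = (-1)^m because the count obtained is divisible by 24. *)

Set Implicit Arguments.
Unset Strict Implicit.
Unset Printing Implicit Defensive.

Import Order.TTheory GRing.Theory Num.Theory.
Local Open Scope ring_scope.

(** * The quadratic character *)

Lemma sum_indicator (I : finType) (P : pred I) :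
  \sum_(i : I) (P i)%:R = #|[set i | P i]|%:R :> int.
Proof.
by rewrite -sum1dep_card natr_sum [RHS]big_mkcond; apply: eq_bigr => i _; case: (P i).
Qed.

Lemma sum_const_int (I : finType) (c : int) : \sum_(i : I) c = c * #|I|%:R.
Proof. by rewrite sumr_const mulr_natr. Qed.

Section QuadraticCharacter.

Variable F : finFieldType.
Implicit Types x y z : F.

(** Counting square roots turns point counts directly into character sums. In odd characteristic the
    values are [1] on nonzero squares, [0] at [0] and [-1] on non-squares. *)
Definition chi x : int := locked (#|[set y | y ^+ 2 == x]|%:R - 1).

Lemma chiE x : chi x = #|[set y | y ^+ 2 == x]|%:R - 1.
Proof. by rewrite /chi -lock. Qed.

Lemma card_sqrt x : #|[set y | y ^+ 2 == x]|%:R = 1 + chi x :> int.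
Proof. by rewrite !chiE addrC subrK. Qed.

Lemma chi0 : chi 0 = 0.
Proof.
rewrite !chiE (_ : [set y | _] = [set 0]) ?cards1 ?subrr //.
by apply/setP=> y; rewrite !inE sqrf_eq0.
Qed.

(** Each [y] is a square root of exactly one [x], so the root counts add up to [#|F|]. *)
Lemma sum_chi : \sum_x chi x = 0.
Proof.
rewrite (eq_bigr _ (fun x _ => chiE x)) sumrB sum_const_int mul1r.
apply/eqP; rewrite subr_eq0; apply/eqP.
have -> : \sum_(x : F) #|[set y | y ^+ 2 == x]|%:R
   = \sum_(x : F) \sum_(y : F) (y ^+ 2 == x)%:R :> int.
  by apply: eq_bigr => x _; rewrite sum_indicator.
rewrite exchange_big /= -[RHS]mul1r -sum_const_int; apply: eq_bigr => y _.
rewrite sum_indicator (_ : [set i | _] = [set y ^+ 2]) ?cards1 //.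
by apply/setP=> x; rewrite !inE eq_sym.
Qed.

Hypothesis two_neq0 : 2%:R != 0 :> F.

Lemma oppr_neq x : x != 0 -> x != - x.
Proof.
move=> x0; rewrite -subr_eq0 opprK -mulr2n -mulr_natr mulf_eq0 negb_or x0.
by rewrite two_neq0.
Qed.

Lemma chi_sqr x : x != 0 -> chi (x ^+ 2) = 1.
Proof.
move=> x0; rewrite !chiE (_ : [set y | _] = [set x; - x]).
  by rewrite cards2 oppr_neq.
by apply/setP=> y; rewrite !inE eqf_sqr.
Qed.

Lemma chiP x : x != 0 -> (exists2 y, y != 0 & x = y ^+ 2) \/ chi x = -1.
Proof.
move=> x0; have [/eqP a|] := boolP (#|[set y | y ^+ 2 == x]| == 0%N).
  by right; rewrite !chiE a.
rewrite cards_eq0 => /set0Pn[y]; rewrite inE => /eqP yx; left; exists y => //.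
by apply: contraNneq x0 => y0; rewrite -yx y0 expr0n.
Qed.

Lemma chi_sign x : x != 0 -> chi x = 1 \/ chi x = -1.
Proof. by case/chiP=> [[y y0 ->]|]; [left; exact: chi_sqr | right]. Qed.

Lemma chi_sqrM x y : x != 0 -> chi (x ^+ 2 * y) = chi y.
Proof.
move=> x0; rewrite !chiE; congr (_%:R - 1).
rewrite -(card_imset [set z | z ^+ 2 == y] (mulfI x0)).
congr #|pred_of_set _|; apply/setP=> z; rewrite inE.
apply/eqP/imsetP=> [zx|[w]]; last by rewrite inE => /eqP <- ->; rewrite exprMn.
exists (x^-1 * z); last by rewrite mulVKf.
by rewrite inE exprMn zx exprVn mulKf // expf_neq0.
Qed.

(* For a non-square x the sum over z of chi z + chi (x z) vanishes, while none of its terms is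
   positive. *)
Lemma chiM x y : chi (x * y) = chi x * chi y.
Proof.
have [->|x0] := eqVneq x 0; first by rewrite mul0r chi0 mul0r.
have [->|y0] := eqVneq y 0; first by rewrite mulr0 chi0 mulr0.
have [[a a0 ->]|chix] := chiP x0; first by rewrite chi_sqrM ?chi_sqr ?mul1r.
have [[a a0 ->]|chiy] := chiP y0.
  by rewrite mulrC chi_sqrM // chi_sqr // mulr1.
rewrite chix chiy mulrNN mulr1.
suff: 0 - (chi y + chi (x * y)) = 0 by rewrite chiy; lia.
have sum0 : \sum_z (0 - (chi z + chi (x * z))) = 0.
  rewrite sumrB big_split /= sum_chi -(reindex_inj (mulfI x0) (P := predT)) sum_chi.
  by rewrite big1_eq.
apply: (psumr_eq0P _ sum0) => // z _.
have [->|z0] := eqVneq z 0; first by rewrite mulr0 chi0.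
have [[a a0 ->]|chiz] := chiP z0.
  by rewrite mulrC chi_sqrM // chi_sqr // chix.
by rewrite chiz; have [->|->] := chi_sign (mulf_neq0 x0 z0).
Qed.

Lemma chi1 : chi 1 = 1.
Proof. by rewrite -(expr1n _ 2) chi_sqr ?oner_eq0. Qed.

Lemma chi_neq0_sqr x : chi x ^+ 2 = (x != 0)%:R.
Proof.
have [->|x0] := eqVneq x 0; first by rewrite chi0.
by rewrite expr2 -chiM -expr2 chi_sqr.
Qed.

(** With [z = k - x] the argument is [z * (2 * k - z)], which for [z != 0] is [z^2] times
    [2 * k / z - 1]. As [2 * k / z] takes every nonzero value once, only the term [chi (-1)] is
    missing from a full sum of [chi]. *)
Lemma sum_chi_split (k : F) : k != 0 ->
  \sum_x chi ((k - x) * (k + x)) = - chi (-1).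
Proof.
move=> k0.
have subK : involutive (fun x => k - x) by move=> x; ring.
rewrite (reindex_inj (inv_inj subK)) /=.
rewrite (eq_bigr (fun z => if z == 0 then 0 else chi (z^-1 * (2 * k) - 1))) => [|z _]; last first.
  have [->|z0] := eqVneq z 0; first by rewrite subr0 subrr mul0r chi0.
  by rewrite -(chi_sqrM (z^-1 * _ - 1) z0); congr chi; field.
have inj : injective (fun z => z / (2 * k)).
  by apply: mulIf; rewrite invr_eq0 mulf_neq0.
(* Since [0^-1 = 0], inversion permutes all of [F] and the exceptional term stays at [z = 0]. *)
rewrite (reindex_inj invr_inj) /= (reindex_inj inj) /=.
rewrite (eq_bigr (fun z => chi (z - 1) - (if z == 0 then chi (-1) else 0))) => [|z _].
  rewrite sumrB -big_mkcond /= big_pred1_eq.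
  by rewrite -(reindex_inj (addIr (-1)) (P := predT)) sum_chi sub0r.
rewrite invr_eq0 mulf_eq0 invr_eq0 mulf_eq0 (negPf two_neq0) (negPf k0) !orbF.
have [->|z0] := eqVneq z 0; first by rewrite sub0r subrr.
by rewrite invrK divfK ?subr0 ?mulf_neq0.
Qed.

End QuadraticCharacter.

(** * Character sums in characteristic 3 *)

Lemma natmul3_eq0 (R : comPzRingType) (R3 : 3%:R = 0 :> R) k : (3 * k)%:R = 0 :> R.
Proof. by rewrite natrM R3 mul0r. Qed.

Lemma oppr_natmul3_eq0 (R : comPzRingType) (R3 : 3%:R = 0 :> R) k : - (3 * k)%:R = 0 :> R.
Proof. by rewrite natmul3_eq0 ?oppr0. Qed.

(* [ring: h] only discards monomials whose coefficient is literally the left-hand side of h,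
   hence the list of multiples of 3. *)
Ltac ring3 h := apply: subr0_eq;
  ring: h (natmul3_eq0 h 2) (natmul3_eq0 h 3) (natmul3_eq0 h 4) (natmul3_eq0 h 5)
    (natmul3_eq0 h 6) (oppr_natmul3_eq0 h 1) (oppr_natmul3_eq0 h 2)
    (oppr_natmul3_eq0 h 3) (oppr_natmul3_eq0 h 4) (oppr_natmul3_eq0 h 5)
    (oppr_natmul3_eq0 h 6).

Lemma sum_eq1 (I : finType) (a : I) : \sum_x (x == a)%:R = 1 :> int.
Proof.
rewrite sum_indicator (_ : [set i | _] = [set a]) ?cards1 //.
by apply/setP=> x; rewrite !inE.
Qed.

Section CharacteristicThree.

Variable F : finFieldType.
Hypothesis F3 : 3%:R = 0 :> F.
Implicit Types u v w x y z s p : F.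

Let q : int := #|F|%:R.

Lemma two_neq0 : 2%:R != 0 :> F.
Proof.
have -> : 2%:R = -1 :> F by ring3 F3.
by rewrite oppr_eq0 oner_eq0.
Qed.
Local Hint Resolve two_neq0 : core.

Lemma oner_neqN1 : 1 != -1 :> F.
Proof. exact/oppr_neq/oner_neq0. Qed.

Lemma cube_inj : injective (fun x : F => x ^+ 3).
Proof.
move=> x y /= xy; have: (x - y) ^+ 3 == 0.
  have -> : (x - y) ^+ 3 = x ^+ 3 - y ^+ 3 by ring3 F3.
  by rewrite xy subrr.
by rewrite expf_eq0 subr_eq0 => /eqP.
Qed.

Lemma cubeB_eq0 u : (u ^+ 3 - u == 0) = (u \in [:: 0; 1; -1]).
Proof.
have -> : u ^+ 3 - u = u * ((u - 1) * (u + 1)) by ring.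
by rewrite !mulf_eq0 subr_eq0 addr_eq0 !inE.
Qed.

Lemma F3_uniq : uniq [:: 0; 1; -1 : F].
Proof.
by rewrite /= !inE negb_or eq_sym oner_eq0 eq_sym oppr_eq0 oner_eq0 oner_neqN1.
Qed.

Lemma card_F3 : #|[set u : F | u ^+ 3 - u == 0]| = 3%N.
Proof.
rewrite -[RHS](card_uniqP F3_uniq); apply: eq_card => u.
by rewrite inE cubeB_eq0.
Qed.

(** For [b != 0] the equation is [w^2 = a / b], and [a / b] differs from [a * b] by a square factor.
    For [b = 0] either every [w] or none is a solution; the last term corrects for this. *)
Lemma count_scaled_sqr (a b : F) :
  #|[set w | a == w ^+ 2 * b]|%:R
  = 1 + chi (a * b) + (b == 0%R)%:R * ((a == 0%R)%:R * q - 1) :> int.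
Proof.
have [->|b0] := eqVneq b 0.
  rewrite mulr0 chi0 addr0 mul1r addrC subrK.
  have [->|a0] := eqVneq a 0.
    by rewrite mul1r; congr (_%:R); apply: eq_card => w; rewrite inE mulr0 eqxx.
  rewrite mul0r (_ : [set w | _] = set0) ?cards0 //; apply/setP=> w.
  by rewrite !inE mulr0 (negPf a0).
rewrite mul0r addr0 -(@chi_sqrM _ b^-1) ?invr_eq0 // -card_sqrt; congr (_%:R).
apply: eq_card => w; rewrite !inE.
have -> : b^-1 ^+ 2 * (a * b) = a / b by field; exact: b0.
by rewrite -[RHS](inj_eq (mulIf b0)) divfK // eq_sym.
Qed.

(** If [k != 0], each [x] determines [v]; otherwise [v] is free and [x] is one of the three roots of
    [x^3 - x]. *)
Lemma count_F3_mul (k : F) :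
  \sum_(x : F) \sum_(v : F) (x ^+ 3 - x == k * v)%:R = (if k == 0 then 3 * q else q).
Proof.
have [->|k0] := eqVneq k 0.
  transitivity (\sum_(x : F) q * (x ^+ 3 - x == 0)%:R).
    by apply: eq_bigr => z _; rewrite mulrC -sum_const_int; apply: eq_bigr => v _; rewrite mul0r.
  by rewrite -mulr_sumr sum_indicator card_F3 mulrC.
transitivity (\sum_(x : F) 1 : int); last by rewrite sum_const_int mul1r.
apply: eq_bigr => z _; rewrite -[RHS](sum_eq1 ((z ^+ 3 - z) / k)).
by apply: eq_bigr => v _; rewrite -[in RHS](inj_eq (mulIf k0)) divfK // mulrC eq_sym.
Qed.

(** The roots are [0], [1], [-1] and the square roots of [-1], which are none of the first three. *)
Lemma count_sqr_eq_pow6 : \sum_(c : F) (c ^+ 2 - c ^+ 6 == 0 :> F)%:R = 4 + chi (-1 : F).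
Proof.
have -> : 4 + chi (-1 : F) = 1 + 2 + (1 + chi (-1 : F)) by ring.
rewrite -card_sqrt.
rewrite (eq_bigr (fun c : F => (c == 0)%:R + (c == 1)%:R + (c == -1)%:R + (c ^+ 2 == -1)%:R)).
  by rewrite !big_split /= !sum_eq1 sum_indicator.
move=> c _.
have -> : c ^+ 2 - c ^+ 6 = - (c ^+ 2 * ((c - 1) * (c + 1) * (c ^+ 2 + 1))) by ring.
rewrite oppr_eq0 !mulf_eq0 orbb subr_eq0 !addr_eq0.
have [->|c0] := eqVneq c 0.
  by rewrite expr0n /= eq_sym oner_eq0 eq_sym oppr_eq0 oner_eq0.
have [->|c1] := eqVneq c 1; first by rewrite expr1n (negPf oner_neqN1).
have [->|cN1] := eqVneq c (-1); first by rewrite sqrrN expr1n (negPf oner_neqN1).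
by case: (c ^+ 2 == -1).
Qed.

(* Counting the points of u^3 - u = w^2 (v^3 - v): as w = c^3 for a unique c, the substitution
   u = x + c^2 v turns the equation into x^3 - x = (c^2 - c^6) v, which is linear in v. *)
Lemma sqr_sum_chi_cubic :
  (\sum_(u : F) chi (u ^+ 3 - u)) ^+ 2 = 2 * q + 2 * q * chi (-1 : F).
Proof.
pose h u : F := u ^+ 3 - u.
pose E : int := \sum_(u : F) \sum_(v : F) \sum_(w : F) (h u == w ^+ 2 * h v)%:R.
(* Here [w] is counted first; the three zeros of [h] account for [3 * (3 * q - q) = 6 * q]. *)
have E1 : E = q ^+ 2 + (\sum_(u : F) chi (h u)) ^+ 2 + 6 * q.
  have -> : E = \sum_(u : F) \sum_(v : F) (1 + chi (h u) * chi (h v)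
      + (h v == 0)%:R * ((h u == 0)%:R * q - 1)).
    apply: eq_bigr => u _; apply: eq_bigr => v _.
    by rewrite sum_indicator count_scaled_sqr chiM.
  have -> : \sum_(u : F) \sum_(v : F) (1 + chi (h u) * chi (h v)
      + (h v == 0)%:R * ((h u == 0)%:R * q - 1))
    = \sum_(u : F) (q + chi (h u) * \sum_(v : F) chi (h v) + 3 * ((h u == 0)%:R * q - 1)).
    apply: eq_bigr => u _; rewrite !big_split /= sum_const_int mul1r.
    by rewrite -mulr_sumr -mulr_suml sum_indicator card_F3.
  rewrite !big_split /= sum_const_int -mulr_suml -mulr_sumr sumrB -mulr_suml.
  rewrite sum_indicator card_F3 sum_const_int -/q; ring.
have E2 : E = q ^+ 2 + 2 * q * (4 + chi (-1 : F)).
  have -> : E = \sum_(c : F) \sum_(x : F) \sum_(v : F) (x ^+ 3 - x == (c ^+ 2 - c ^+ 6) * v)%:R.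
    rewrite /E (eq_bigr _ (fun u _ => exchange_big _ _ _ _ _ _)) /= exchange_big /=.
    rewrite (reindex_inj cube_inj) /=; apply: eq_bigr => c _.
    rewrite exchange_big [RHS]exchange_big /=; apply: eq_bigr => v _.
    rewrite (reindex_inj (addIr (c ^+ 2 * v))) /=; apply: eq_bigr => x _.
    rewrite -[in LHS]subr_eq0 -[in RHS]subr_eq0; congr (_ == _)%:R.
    by rewrite /h; ring3 F3.
  rewrite (eq_bigr _ (fun c _ => count_F3_mul _)) -count_sqr_eq_pow6 mulr_sumr.
  have -> : q ^+ 2 = \sum_(c : F) q by rewrite sum_const_int expr2.
  rewrite -big_split /=; apply: eq_bigr => c _.
  by case: eqP => _; rewrite /= ?mulr1n ?mulr0n; ring.
apply: (addIr (q ^+ 2 + 6 * q)); transitivity E; first by rewrite E1; ring.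
by rewrite E2; ring.
Qed.

(** The discriminant [s^2 - 4 p] is [s^2 - p] in characteristic 3, and completing the square is the
    translation by [s] because [2 = -1]. *)
Lemma count_root_quadratic s p :
  \sum_(u : F) (u * (s - u) == p)%:R = 1 + chi (s ^+ 2 - p).
Proof.
rewrite -card_sqrt -sum_indicator [RHS](reindex_inj (addIr s)) /=.
apply: eq_bigr => u _; rewrite -[in LHS]subr_eq0 -[in RHS]subr_eq0 -[in LHS]oppr_eq0.
by congr (_ == _)%:R; ring3 F3.
Qed.

(** There are [1 + chi (s^2 - p)] pairs [(u, v)] with sum [s] and product [p]. Hence the squared
    cubic sum is the sum of [chi (g s p)] plus its twist by [chi (s^2 - p)], and the twist is the
    required sum up to the sign [chi (-1)]. *)
Lemma sum_chi_kummer :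
  \sum_(s : F) \sum_(p : F) chi ((p - s ^+ 2) * (p * ((p + 1) ^+ 2 - s ^+ 2)))
  = 2 * q + q * chi (-1 : F).
Proof.
pose g s p : F := p * ((p + 1) ^+ 2 - s ^+ 2).
(* For fixed [p] the sum over [s] is given by [sum_chi_split] with [k = p + 1]; at [p = -1] the
   argument degenerates to [s^2], which produces the extra [q]. *)
have sum_g : \sum_(s : F) \sum_(p : F) chi (g s p) = q.
  rewrite exchange_big /=.
  have -> : \sum_(p : F) \sum_(s : F) chi (g s p) = \sum_(p : F) ((p == -1)%:R * q - chi (- p)).
    apply: eq_bigr => p _.
    have -> : \sum_(s : F) chi (g s p) = chi p * \sum_(s : F) chi ((p + 1 - s) * (p + 1 + s)).
      by rewrite mulr_sumr; apply: eq_bigr => s _; rewrite -chiM // /g subr_sqr.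
    have [->|p1] := eqVneq p (-1).
      rewrite addNr mul1r opprK chi1 //.
      transitivity (chi (-1 : F) * \sum_(s : F) (chi (-1 : F) * (1 - (s == 0)%:R))).
        congr (_ * _); apply: eq_bigr => s _; rewrite sub0r add0r mulNr -mulN1r chiM //.
        congr (_ * _); rewrite chiM // -expr2 chi_neq0_sqr //.
        by case: eqP.
      rewrite -mulr_sumr mulrA -expr2 chi_neq0_sqr // oppr_eq0 oner_eq0 mul1r.
      by rewrite sumrB sum_const_int mul1r sum_eq1.
    rewrite mul0r sub0r sum_chi_split ?addr_eq0 ?oner_neqN1 // mulrN -chiM //.
    by rewrite mulrN1.
  rewrite sumrB -mulr_suml sum_eq1 mul1r -(reindex_inj oppr_inj (P := predT)) sum_chi.
  by rewrite subr0.
have key : (\sum_(u : F) chi (u ^+ 3 - u)) ^+ 2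
    = q + \sum_(s : F) \sum_(p : F) chi (g s p) * chi (s ^+ 2 - p).
  rewrite -[X in X + _]sum_g -big_split /=.
  transitivity (\sum_(s : F) \sum_(u : F) chi ((u ^+ 3 - u) * ((s - u) ^+ 3 - (s - u)))).
    rewrite exchange_big expr2 mulr_suml; apply: eq_bigr => u _ /=.
    rewrite mulr_sumr (reindex_inj (addIr (- u))) /=; apply: eq_bigr => s _.
    by rewrite chiM.
  apply: eq_bigr => s _; rewrite -big_split /=.
  transitivity (\sum_(p : F) \sum_(u : F) (u * (s - u) == p)%:R * chi (g s p)).
    rewrite exchange_big; apply: eq_bigr => u _ /=.
    rewrite (bigD1 (u * (s - u))) //= eqxx mul1r big1 ?addr0 => [|p].
      by congr chi; rewrite /g; ring3 F3.
    by rewrite eq_sym => /negPf->; rewrite mul0r.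
  apply: eq_bigr => p _; rewrite -mulr_suml count_root_quadratic; ring.
have -> : \sum_(s : F) \sum_(p : F) chi ((p - s ^+ 2) * (p * ((p + 1) ^+ 2 - s ^+ 2)))
    = chi (-1 : F) * \sum_(s : F) \sum_(p : F) chi (g s p) * chi (s ^+ 2 - p).
  rewrite mulr_sumr; apply: eq_bigr => s _; rewrite mulr_sumr; apply: eq_bigr => p _.
  rewrite -!chiM //; congr chi; rewrite /g; ring.
have -> : \sum_(s : F) \sum_(p : F) chi (g s p) * chi (s ^+ 2 - p) = q + 2 * q * chi (-1 : F).
  apply: (addrI q); rewrite -key sqr_sum_chi_cubic; ring.
have c2 : chi (-1 : F) ^+ 2 = 1 by rewrite chi_neq0_sqr // oppr_eq0 oner_eq0.
transitivity (q * chi (-1 : F) + 2 * q * chi (-1 : F) ^+ 2); first by ring.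
by rewrite c2; ring.
Qed.

End CharacteristicThree.

(** * Counting completions of {oo, 0, 1} *)

Lemma card_bij_in (I J : finType) (A : {set I}) (B : {set J}) (f : I -> J) (g : J -> I) :
    {in A, forall x, f x \in B} -> {in B, forall y, g y \in A} ->
    {in A, cancel f g} -> {in B, cancel g f} ->
  #|A| = #|B|.
Proof.
move=> fA gB fK gK; apply/eqP; rewrite eqn_leq -{1}(card_in_imset (can_in_inj fK)).
rewrite -[in X in _ && X](card_in_imset (can_in_inj gK)) !subset_leq_card //.
  by apply/subsetP=> _ /imsetP[y yB ->]; apply: gB.
by apply/subsetP=> _ /imsetP[x xA ->]; apply: fA.
Qed.

Lemma sum_mem (I : finType) (L : seq I) :
  uniq L -> \sum_x (x \in L)%:R = (size L)%:R :> int.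
Proof.
move=> /card_uniqP <-; rewrite sum_indicator; congr (_%:R).
by apply: eq_card => x; rewrite inE.
Qed.

Section NormalForm.

Variable F : finFieldType.
Hypothesis F3 : 3%:R = 0 :> F.
Implicit Types s p y : F.

Let q : int := #|F|%:R.
Let twoF := two_neq0 F3.
Local Hint Resolve twoF : core.

Definition kummer s p y : F := (p - s ^+ 2) * y ^+ 2 - p * ((p + 1) ^+ 2 - s ^+ 2).

(** On the surface, the three inequations express that the six points [0], [1], [x1], .., [x4] are
    distinct, see [uniq_kummer]. *)
Definition kummer_points : {set F * F * F} :=
  [set t | let: (s, p, y) := t in
    [&& s ^+ 3 - s != 0, p \notin [:: 1; s; - s], y != 0 & kummer s p y == 0]].

(** For [kummer] written as [b y^2 - a], this is [b * a]. *)
Definition kummer_disc s p : F := (p - s ^+ 2) * (p * ((p + 1) ^+ 2 - s ^+ 2)).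

Lemma notin_F3 s : (s ^+ 3 - s != 0) = [&& s != 0, s != 1 & s != -1].
Proof. by rewrite cubeB_eq0 !inE !negb_or. Qed.

Lemma kummer_on_cone s y : s ^+ 3 - s != 0 -> kummer s (s ^+ 2) y != 0.
Proof.
move=> sF; have -> : kummer s (s ^+ 2) y = - (s ^+ 3 - s) ^+ 2 by rewrite /kummer; ring3 F3.
by rewrite oppr_eq0 expf_neq0.
Qed.

(** For [b != 0] there are [1 + chi (a * b)] roots, and [y = 0] is one of them exactly when [a = 0];
    removing it leaves the indicator. For [b = 0], that is [p = s^2], there are none by
    [kummer_on_cone]. *)
Lemma count_kummer_y s p : s ^+ 3 - s != 0 ->
  \sum_(y : F) ((y != 0) && (kummer s p y == 0))%:R
  = chi (kummer_disc s p) + (kummer_disc s p != 0%R)%:R.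
Proof.
move=> sF; set b := p - s ^+ 2; set a := p * ((p + 1) ^+ 2 - s ^+ 2).
transitivity (\sum_(y : F) ((a == y ^+ 2 * b)%:R - (y == 0)%:R * (a == 0)%:R) : int).
  apply: eq_bigr => y _.
  have -> : (kummer s p y == 0) = (a == y ^+ 2 * b).
    by rewrite subr_eq0 eq_sym [_ * b]mulrC.
  have [->|_] := eqVneq y 0; last by rewrite mul0r subr0.
  by rewrite expr0n mul0r mul1r subrr.
rewrite sumrB sum_indicator count_scaled_sqr // -mulr_suml sum_eq1 mul1r.
rewrite /kummer_disc -/a -/b [b * a]mulrC.
have [b0|b0] := eqVneq b 0.
  have a0 : (a == 0) = false.
    move/eqP: b0; rewrite subr_eq0 => /eqP ps.
    apply/negbTE; move: (kummer_on_cone 0 sF).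
    by rewrite /kummer expr0n mulr0 sub0r oppr_eq0 /a -ps.
  by rewrite a0 b0 mulr0 chi0 eqxx /=; ring.
have [->|a0] := eqVneq a 0; first by rewrite mul0r chi0 eqxx /=; ring.
by rewrite mulf_neq0 //=; ring.
Qed.

(** The first three values are those excluded from [kummer_points], the other four are the zeros of
    [kummer_disc]. Up to sign, each difference is a product of factors among [1], [s], [s - 1],
    [s + 1]. *)
Lemma uniq_special_p s : s ^+ 3 - s != 0 ->
  uniq [:: 1; s; - s; s ^+ 2; 0; s - 1; - s - 1].
Proof.
rewrite notin_F3 => /and3P[s0 s1 sN1].
have s1' : s - 1 != 0 by rewrite subr_eq0.
have sN1' : s + 1 != 0 by rewrite addr_eq0.
have ne x y z : z != 0 -> x - y = z -> x != y by move=> z0 e; rewrite -subr_eq0 e.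
have neg z : z != 0 -> - z != 0 by rewrite oppr_eq0.
rewrite /= !inE !negb_or -!andbA.
apply/and5P; split.
- by apply: (ne _ _ (- (s - 1))); [exact: neg | ring].
- by apply: (ne _ _ (s + 1)); [| ring].
- by apply: (ne _ _ (- ((s - 1) * (s + 1)))); [rewrite neg ?mulf_neq0 | ring].
- exact: oner_neq0.
apply/and5P; split.
- by apply: (ne _ _ (- (s + 1))); [exact: neg | ring3 F3].
- by apply: (ne _ _ (s - 1)); [| ring3 F3].
- by apply: (ne _ _ (- s)); [exact: neg | ring3 F3].
- by apply: (ne _ _ (- s * (s - 1))); [rewrite mulf_neq0 ?neg | ring].
apply/and5P; split.
- by [].
- by apply: (ne _ _ 1); [exact: oner_neq0 | ring].
- by apply: (ne _ _ (- (s - 1))); [exact: neg | ring3 F3].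
- by apply: (ne _ _ (- (s * (s + 1)))); [rewrite neg ?mulf_neq0 | ring].
apply/and5P; split.
- exact: neg.
- by apply: (ne _ _ (s + 1)); [| ring3 F3].
- by apply: (ne _ _ 1); [exact: oner_neq0 | ring].
- exact: expf_neq0.
apply/and5P; split.
- by apply: (ne _ _ ((s + 1) ^+ 2)); [rewrite expf_neq0 | ring3 F3].
- by apply: (ne _ _ ((s - 1) ^+ 2)); [rewrite expf_neq0 | ring3 F3].
- by rewrite eq_sym.
- by rewrite eq_sym -opprD oppr_eq0.
rewrite andbT.
by apply: (ne _ _ (- s)); [exact: neg | ring3 F3].
Qed.

Lemma kummer_disc_eq0 s p :
  (kummer_disc s p == 0) = (p \in [:: s ^+ 2; 0; s - 1; - s - 1]).
Proof.
have -> : kummer_disc s p = (p - s ^+ 2) * (p * ((p - (s - 1)) * (p - (- s - 1)))).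
  by rewrite /kummer_disc; ring.
by rewrite !mulf_eq0 !subr_eq0 !inE.
Qed.

Lemma chi_kummer_disc_special s p : s ^+ 3 - s != 0 ->
  p \in [:: 1; s; - s] -> chi (kummer_disc s p) = 1.
Proof.
rewrite notin_F3 !inE => /and3P[s0 s1 sN1].
have s1' : s - 1 != 0 by rewrite subr_eq0.
have sN1' : s + 1 != 0 by rewrite addr_eq0.
suff sqr z : z != 0 -> kummer_disc s p = z ^+ 2 -> chi (kummer_disc s p) = 1.
  case/or3P => /eqP e.
  - by apply: (sqr ((s - 1) * (s + 1))); rewrite ?mulf_neq0 // e /kummer_disc; ring3 F3.
  - by apply: (sqr (s * (s - 1))); rewrite ?mulf_neq0 // e /kummer_disc; ring3 F3.
  - by apply: (sqr (s * (s + 1))); rewrite ?mulf_neq0 // e /kummer_disc; ring3 F3.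
by move=> z0 ->; apply: chi_sqr.
Qed.

(** Here [10 = 2 * 3 + 4]: at each of the three excluded [p] the discriminant is a nonzero square, a
    loss of [2], and at each of its four zeros the indicator is lost. *)
Lemma kummer_row s : s ^+ 3 - s != 0 ->
  \sum_(p : F) (p \notin [:: 1; s; - s])%:R *
      (chi (kummer_disc s p) + (kummer_disc s p != 0%R)%:R)
  = \sum_(p : F) chi (kummer_disc s p) + q - 10.
Proof.
move=> sF.
have uL := uniq_special_p sF.
have uL3 : uniq [:: 1; s; - s].
  by exact: (subseq_uniq (prefix_subseq _ [:: s ^+ 2; 0; s - 1; - s - 1])).
have uL4 : uniq [:: s ^+ 2; 0; s - 1; - s - 1].
  by exact: (subseq_uniq (suffix_subseq [:: 1; s; - s] _)).
transitivity (\sum_(p : F) (chi (kummer_disc s p) + 1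
    - 2 * (p \in [:: 1; s; - s])%:R
    - (p \in [:: s ^+ 2; 0; s - 1; - s - 1])%:R)).
  apply: eq_bigr => p _; rewrite kummer_disc_eq0.
  have [p3|_] := boolP (p \in [:: 1; s; - s]).
    have /negPf-> : p \notin [:: s ^+ 2; 0; s - 1; - s - 1].
      apply/negP=> p4; move: uL; rewrite (cat_uniq [:: 1; s; - s]) => /and3P[_ /hasP[]].
      by exists p.
    by rewrite chi_kummer_disc_special.
  have [p4|_] := boolP (p \in _); last by rewrite mul1r mulr0 !subr0.
  have /eqP-> : kummer_disc s p == 0 by rewrite kummer_disc_eq0.
  by rewrite chi0.
rewrite !sumrB big_split /= -mulr_sumr sum_const_int !sum_mem //= -/q; ring.
Qed.

(** For [s] in the prime field the discriminant is a square with two zeros. These rows carry no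
    points but occur in [sum_chi_kummer]. *)
Lemma kummer_row_F3 s : s ^+ 3 - s == 0 ->
  \sum_(p : F) chi (kummer_disc s p) = q - 2.
Proof.
have two (t z : F) : z != 0 -> (forall p, kummer_disc t p = (p * (p - z)) ^+ 2) ->
    \sum_(p : F) chi (kummer_disc t p) = q - 2.
  move=> z0 e; transitivity (\sum_(p : F) (1 - (p \in [:: 0; z])%:R) : int).
    apply: eq_bigr => p _; rewrite e expr2 chiM // -expr2 chi_neq0_sqr //.
    by rewrite mulf_eq0 subr_eq0 !inE; case: (_ || _).
  by rewrite sumrB sum_const_int mul1r sum_mem //= inE eq_sym z0.
rewrite cubeB_eq0 !inE => /or3P[] /eqP->.
- by apply: (two _ (-1)) => [|p]; rewrite ?oppr_eq0 ?oner_eq0 // /kummer_disc; ring3 F3.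
- by apply: (two _ 1) => [|p]; rewrite ?oner_eq0 // /kummer_disc; ring3 F3.
- by apply: (two _ 1) => [|p]; rewrite ?oner_eq0 // /kummer_disc; ring3 F3.
Qed.

Lemma card_kummer_points :
  #|kummer_points|%:R = q ^+ 2 + (chi (-1 : F) - 14) * q + 36.
Proof.
rewrite -sum_indicator.
transitivity (\sum_(s : F) \sum_(p : F) \sum_(y : F)
   ((s ^+ 3 - s != 0%R) && (p \notin [:: 1; s; - s]))%:R
    * ((y != 0) && (kummer s p y == 0))%:R : int).
  rewrite pair_bigA pair_bigA /=; apply: eq_bigr => -[[s p] y] _ /=.
  by rewrite -natrM mulnb -!andbA.
(* For [s] in the prime field, [2 q - 12 = (q - 2) + (q - 10)] cancels the formula of the generic
   row. *)
transitivity (\sum_(s : F) (\sum_(p : F) chi (kummer_disc s p) + q - 10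
     - (s ^+ 3 - s == 0)%:R * (2 * q - 12))).
  apply: eq_bigr => s _; have [s3|s3] := boolP (s ^+ 3 - s == 0).
    rewrite kummer_row_F3 //= big1 => [|p _]; first by ring.
    by rewrite big1 // => y _; rewrite mul0r.
  rewrite mul0r subr0 -kummer_row //; apply: eq_bigr => p _.
  by rewrite -count_kummer_y // mulr_sumr.
rewrite !sumrB big_split /= !sum_const_int -mulr_suml sum_indicator card_F3 //.
rewrite sum_chi_kummer // -/q; ring.
Qed.

(** * Rescaling the completions to points of the surface *)

Implicit Types x : F.

Definition esym3 x1 x2 x3 x4 : F := x1 * x2 * x3 + x1 * x2 * x4 + x1 * x3 * x4 + x2 * x3 * x4.

(** The equations are the vanishing of the first and fourth elementary symmetric functions of [x1],
    .., [x4], [1]. The quadruples are ordered, so a block will be counted [4!] times. *)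
Definition completions : {set F * F * F * F} :=
  [set t | let: (x1, x2, x3, x4) := t in
    [&& uniq [:: 0; 1; x1; x2; x3; x4], x1 + x2 + x3 + x4 + 1 == 0
      & esym3 x1 x2 x3 x4 + x1 * x2 * x3 * x4 == 0]].

Lemma esym_kummer s p y i : (1 - y) * i = 1 ->
  let x1 := (1 - p) * i in let x2 := (s - p) * i in
  let x3 := (- s - p) * i in let x4 := (1 + y) * i in
  esym3 x1 x2 x3 x4 + x1 * x2 * x3 * x4 = - (i ^+ 4 * kummer s p y).
Proof.
(* Inserting [(1 - y) * i] for a factor [1] in the cubic term makes both terms of degree 4 in
   [i]. *)
move=> yi /=; rewrite -[esym3 _ _ _ _]mulr1 -[X in _ * X + _]yi /esym3 /kummer; ring3 F3.
Qed.

(** Dividing by [k] normalises the first three entries to sum [1]; then [1 - p], [s - p] and [1 + y]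
    are read off from [x1], [x2] and [x4], and the entry [1] becomes [1 - y]. *)
Definition to_kummer (t : F * F * F * F) : F * F * F :=
  let: (x1, x2, x3, x4) := t in
  let k := x1 + x2 + x3 in let p := 1 - x1 / k in (p + x2 / k, p, x4 / k - 1).

Definition of_kummer (t : F * F * F) : F * F * F * F :=
  let: (s, p, y) := t in
  let e := 1 - y in ((1 - p) / e, (s - p) / e, (- s - p) / e, (1 + y) / e).

(** If the sum were [0], then [x4 = -1] and the second equation would become [(x1 - x2)^2 = 0]. *)
Lemma completions_sum3_neq0 x1 x2 x3 x4 :
  (x1, x2, x3, x4) \in completions -> x1 + x2 + x3 != 0.
Proof.
rewrite inE => /and3P[xU /eqP sum0 /eqP e0]; apply/negP => /eqP k0.
move: xU; rewrite /= !inE !negb_or => /and4P[_ _ /and3P[x12 _ _] _].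
case/negP: x12; rewrite -subr_eq0 -sqrf_eq0; apply/eqP.
have x4E : x4 = -1 by apply/eqP; rewrite -subr_eq0 opprK -sum0 k0 add0r.
have x3E : x3 = - x1 - x2 by apply: subr0_eq; rewrite -k0; ring.
by rewrite -e0 x4E x3E /esym3; ring3 F3.
Qed.

Lemma to_kummerK : {in completions, cancel to_kummer of_kummer}.
Proof.
move=> [[[x1 x2] x3] x4] xC; have k0 := completions_sum3_neq0 xC.
move: xC; rewrite inE => /and3P[_ /eqP sum0 _] /=.
set k := x1 + x2 + x3 in k0 sum0 *.
(* Since [2 = -1], the left side is [(- k - x4) / k], and [- k - x4 = 1]. *)
have -> : 1 - (x4 / k - 1) = k^-1.
  apply: (mulIf k0); rewrite mulVf // mulrBl mulrBl divfK //.
  by apply: subr0_eq; rewrite -oppr0 -sum0; ring3 F3.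
rewrite invrK; congr (_, _, _, _).
- by rewrite subKr divfK.
- by rewrite addrAC subrr add0r divfK.
- have -> : - (1 - x1 / k + x2 / k) - (1 - x1 / k)
      = 1 - (x1 / k + x2 / k) + 3%:R * (x1 / k - 1) by ring.
  by rewrite F3 mul0r addr0 mulrBl mulrDl !divfK // mul1r /k; ring.
- by rewrite addrC subrK divfK.
Qed.

(** Some coincidences are excluded literally by the right-hand side. Each of the others has the form
    [y = c] or [y = - c], and putting [y^2 = c^2] into [kummer] gives a product of nonzero
    factors. *)
Lemma uniq_kummer s p y : kummer s p y = 0 ->
  uniq [:: 0; 1 - y; 1 - p; s - p; - s - p; 1 + y]
  = [&& s ^+ 3 - s != 0, p \notin [:: 1; s; - s] & y != 0].
Proof.
move=> E; apply/idP/idP.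
  set l := (l in uniq l) => ul.
  have d i j : [&& i < 6, j < 6 & i != j]%N -> l`_i != l`_j.
    by case/and3P=> i6 j6 ij; rewrite (@nth_uniq _ 0 l i j).
  rewrite notin_F3 !inE !negb_or -!andbA.
  apply/and5P; split; [| | | | apply/and3P; split].
  - by apply: contraNneq (d 3 4 isT) => e; rewrite /l /= e oppr0.
  - by apply: contraNneq (d 2 3 isT) => e; rewrite /l /= e.
  - by apply: contraNneq (d 2 4 isT) => e; rewrite /l /= e opprK.
  - by apply: contraNneq (d 0 2 isT) => e; rewrite /l /= e subrr.
  - by apply: contraNneq (d 0 3 isT) => e; rewrite /l /= e subrr.
  - by apply: contraNneq (d 0 4 isT) => e; rewrite /l /= e subrr.
  - by apply: contraNneq (d 1 5 isT) => e; rewrite /l /= e subr0 addr0.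
rewrite notin_F3 !inE !negb_or -!andbA => /and5P[s0 s1 sN1 p1 /and3P[ps pNs y0]].
have {}s1 : s - 1 != 0 by rewrite subr_eq0.
have {}sN1 : s + 1 != 0 by rewrite addr_eq0.
have {}p1 : 1 - p != 0 by rewrite subr_eq0 eq_sym.
have {}ps : s - p != 0 by rewrite subr_eq0 eq_sym.
have {}pNs : - s - p != 0 by rewrite subr_eq0 eq_sym.
have neg (z : F) : z != 0 -> - z != 0 by rewrite oppr_eq0.
have ne (x z w : F) : w != 0 -> x - z = w -> x != z by move=> w0 e; rewrite -subr_eq0 e.
have p0 : p != 0.
  apply: contra_eq_neq E => ->; rewrite (_ : kummer s 0 y = - (s * y) ^+ 2).
    by rewrite neg // expf_neq0 // mulf_neq0.
  by rewrite /kummer; ring.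
(* The value [w] may vanish when [c = 0], but then the coincidence is [y = 0]. *)
have sqr_ne c (w : F) : (c != 0 -> w != 0) -> (y ^+ 2 = c ^+ 2 -> kummer s p y = w) ->
    (c - y != 0) * (c + y != 0).
  move=> w0 yc; suff: (c - y) * (c + y) != 0 by rewrite mulf_eq0 negb_or => /andP[-> ->].
  apply: contra_eq_neq E => e.
  have yE : y ^+ 2 = c ^+ 2 by apply: subr0_eq; rewrite -oppr0 -e; ring.
  by rewrite yc // w0 // -sqrf_eq0 -yE sqrf_eq0.
have kummerE t : y ^+ 2 = t -> kummer s p y = (p - s ^+ 2) * t - p * ((p + 1) ^+ 2 - s ^+ 2).
  by rewrite /kummer => ->.
have y1 : (1 - y != 0) * (1 + y != 0).
  apply: (sqr_ne _ ((1 - p) * (s - p) * (- s - p))); first by rewrite !mulf_neq0.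
  by move/kummerE->; ring3 F3.
have yp : (p - y != 0) * (p + y != 0).
  apply: (sqr_ne _ (p * (1 - p) * ((s - 1) * (s + 1)))); first by rewrite !mulf_neq0.
  by move/kummerE->; ring3 F3.
have ym : (1 + p - s - y != 0) * (1 + p - s + y != 0).
  apply: (sqr_ne _ ((1 + p - s) * (s * ((s - p) * (s - 1))))) => [c0|].
    by rewrite !mulf_neq0.
  by move/kummerE->; ring3 F3.
have yp' : (1 + p + s - y != 0) * (1 + p + s + y != 0).
  apply: (sqr_ne _ ((1 + p + s) * (s * ((- s - p) * (s + 1))))) => [c0|].
    by rewrite !mulf_neq0.
  by move/kummerE->; ring3 F3.
have z0 (z : F) : z != 0 -> 0 != z by rewrite eq_sym.
rewrite /= !inE !negb_or -!andbA.
apply/and5P; split; [exact: z0 y1.1 | exact: z0 | exact: z0 | exact: z0 |].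
apply/and5P; split; first exact: z0 y1.2.
- by apply: (ne _ _ (p - y)); [rewrite yp | ring].
- by apply: (ne _ _ (1 + p - s - y)); [rewrite ym | ring].
- by apply: (ne _ _ (1 + p + s - y)); [rewrite yp' | ring].
apply/and5P; split.
- by apply: (ne _ _ y); [| ring3 F3].
- by apply: (ne _ _ (- (s - 1))); [rewrite neg | ring].
- by apply: (ne _ _ (s + 1)); [| ring].
- by apply: (ne _ _ (- (p + y))); [rewrite neg ?yp | ring].
apply/and4P; split=> //.
- by apply: (ne _ _ (- s)); [rewrite neg | ring3 F3].
- by apply: (ne _ _ (- (1 + p - s + y))); [rewrite neg ?ym | ring].
- by apply: (ne _ _ (- (1 + p + s + y))); [rewrite neg ?yp' | ring].
Qed.

(** Multiplication by [i] takes [1 - y] to the fixed entry [1] and preserves distinctness; the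
    entries have sum [0] identically, so [kummer] is the only equation left. *)
Lemma completions_kummer s p y i : (1 - y) * i = 1 ->
  (((1 - p) * i, (s - p) * i, (- s - p) * i, (1 + y) * i) \in completions)
  = ((s, p, y) \in kummer_points).
Proof.
move=> yi; have i0 : i != 0 by apply: contra_eq_neq yi => ->; rewrite mulr0 eq_sym oner_eq0.
have uE : uniq [:: 0; 1; (1 - p) * i; (s - p) * i; (- s - p) * i; (1 + y) * i]
    = uniq [:: 0; 1 - y; 1 - p; s - p; - s - p; 1 + y].
  by rewrite -[RHS](map_inj_uniq (mulIf i0)) [map _ _]/= mul0r yi.
have sum0 : (1 - p) * i + (s - p) * i + (- s - p) * i + (1 + y) * i + 1 = 0.
  by rewrite -[X in _ + X]yi; ring3 F3.
rewrite !inE /= in uE *; rewrite uE sum0 eqxx (esym_kummer _ _ yi).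
rewrite oppr_eq0 mulf_eq0 expf_eq0 (negPf i0) /=.
have [E|] := eqVneq (kummer s p y) 0; last by rewrite !andbF.
have := uniq_kummer E; rewrite /= !inE => ->; rewrite !andbT.
by [].
Qed.

Lemma to_kummer_in : {in completions, forall t, to_kummer t \in kummer_points}.
Proof.
move=> [[[x1 x2] x3] x4] xC; have k0 := completions_sum3_neq0 xC.
have := to_kummerK xC; move: (xC); rewrite inE => /and3P[_ /eqP sum0 _].
rewrite /to_kummer; set k := x1 + x2 + x3 in k0 sum0 *.
set p := 1 - _; set s := p + _; set y := _ - 1; rewrite /= => xE.
have e1 : (1 - y) * k = 1.
  rewrite /y !mulrBl divfK // mul1r; apply: subr0_eq; rewrite -oppr0 -sum0; ring3 F3.
have y1 : 1 - y != 0 by apply: contra_eq_neq e1 => ->; rewrite mul0r eq_sym oner_eq0.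
by rewrite -(@completions_kummer _ _ _ (1 - y)^-1) ?mulfV // xE.
Qed.

Lemma kummer_points_y s p y : (s, p, y) \in kummer_points -> 1 - y != 0.
Proof.
rewrite inE => /and4P[s0 pN y0 /eqP E]; have := uniq_kummer E.
by rewrite s0 pN y0 /= !inE !negb_or eq_sym => /andP[/andP[]].
Qed.

Lemma of_kummer_in : {in kummer_points, forall t, of_kummer t \in completions}.
Proof.
move=> [[s p] y] tK; have y1 := kummer_points_y tK.
by rewrite /of_kummer completions_kummer ?mulfV.
Qed.

Lemma of_kummerK : {in kummer_points, cancel of_kummer to_kummer}.
Proof.
move=> [[s p] y] /kummer_points_y y1; rewrite /of_kummer /to_kummer -!mulrDl.
have -> : 1 - p + (s - p) + (- s - p) = 1 by ring3 F3.
rewrite mul1r invrK !divfK //; congr (_, _, _); ring.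
Qed.

Lemma card_completions :
  #|completions|%:R = q ^+ 2 + (chi (-1 : F) - 14) * q + 36.
Proof.
rewrite -card_kummer_points; congr (_%:R).
exact: card_bij_in to_kummer_in of_kummer_in to_kummerK of_kummerK.
Qed.

End NormalForm.

(** * Invariance of the blocks *)

Section Membership.

Variable F : finFieldType.
Implicit Types (S : {set P1 F}) (p : {mpoly F[2]}).

Definition mon7 (i : nat) : 'X_{1..2} := [multinom (if j == ord0 then i else 7 - i)%N | j < 2].

Lemma mpolyX_mon7 i : 'X_[F, mon7 i] = varX F ^+ i * varY F ^+ (7 - i).
Proof.
rewrite mpolyXE_id !big_ord_recl big_ord0 mulr1 !mnmE /=.
by congr (_ ^+ _ * 'X_ _ ^+ _); apply/val_inj.
Qed.

Lemma mdeg_mon7 i : (i <= 7)%N -> mdeg (mon7 i) = 7%N.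
Proof. by move=> i7; rewrite mdegE !big_ord_recl big_ord0 !mnmE /= addn0 subnKC. Qed.

Lemma mon7_inj i j : (mon7 i == mon7 j) = (i == j).
Proof.
apply/eqP/eqP=> [e|->] //.
by have := congr1 (fun m : 'X_{1..2} => m ord0) e; rewrite !mnmE.
Qed.

Lemma mon7_mnm (m : 'X_{1..2}) : mdeg m = 7%N -> mon7 (m ord0) = m.
Proof.
rewrite mdegE !big_ord_recl big_ord0 addn0 => m7; apply/mnmP => j; rewrite mnmE.
case: (unliftP ord0 j) => [k ->|-> //] /=.
by rewrite -m7 addnC addnK; congr (m _); rewrite (ord1 k).
Qed.

Lemma homog7_expand p : p \is 7.-homog ->
  p = \sum_(i < 8) p@_(mon7 i) *: 'X_[mon7 i].
Proof.
move=> p7; apply/mpolyP => m; rewrite linear_sum /=.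
under eq_bigr do rewrite mcoeffZ mcoeffX.
have [m7|m7] := eqVneq (mdeg m) 7%N.
  have m0 : (m ord0 < 8)%N by rewrite ltnS -m7 mdegE (bigD1 ord0) //= leq_addr.
  rewrite (bigD1 (Ordinal m0)) //= mon7_mnm // eqxx mulr1 big1 ?addr0 // => i.
  rewrite -val_eqE /= => /negPf im.
  by rewrite -[X in _ == X](mon7_mnm m7) mon7_inj im mulr0.
rewrite (dhomog_nemf_coeff p7) // big1 // => i _.
have [e|_] := eqVneq (mon7 i) m; last by rewrite mulr0.
by case/eqP: m7; rewrite -e mdeg_mon7 // -ltnS.
Qed.

(** The monomials of degree 7 absent from the spanning list are [X^2 Y^5] and [X^5 Y^2]. *)
Lemma mem_W7Luc p : p \is 7.-homog ->
  (indhomog 7 p \in W7Luc F) = (p@_(mon7 2) == 0) && (p@_(mon7 5) == 0).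
Proof.
move=> p7; apply/idP/andP => [pW|[/eqP p2 /eqP p5]].
  suff vanish k : k \in [:: 2; 5]%N -> p@_(mon7 k) = 0 by rewrite !vanish.
  move=> k25; rewrite -(indhomogK p7) (coord_span pW) !linear_sum big1 //= => j _.
  rewrite linearZ /=.
  suff e : (mpoly_of_dhomog (map (indhomog 7) (lucas7_monomials F))`_j)@_(mon7 k) = 0.
    by rewrite [X in _ * X]e mulr0.
  have /mapP[r rL ->] : (map (indhomog 7) (lucas7_monomials F))`_j
      \in map (indhomog 7) (lucas7_monomials F) by apply: mem_nth.
  rewrite indhomogK ?lucas7_monomials_homog //.
  move: rL; rewrite /lucas7_monomials !inE.
  have E i : varX F ^+ i * varY F ^+ (7 - i) = 'X_[mon7 i] by rewrite mpolyX_mon7.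
  have := (E 7, E 6, E 4, E 3, E 1, E 0)%N.
  rewrite !subSS !subn0 !expr0 mulr1 mul1r !expr1 => -[[[[[-> ->] ->] ->] ->] ->].
  move: k25; rewrite !inE => /orP[] /eqP-> /or4P[|||/or3P[]] /eqP->;
    by rewrite mcoeffX mon7_inj.
have -> : indhomog 7 p = \sum_(i < 8) p@_(mon7 i) *: indhomog 7 'X_[mon7 i].
  apply: val_inj; rewrite /= indhomogK // linear_sum {1}(homog7_expand p7).
  apply: eq_bigr => i _; rewrite linearZ /= indhomogK //.
  by rewrite dhomogX /= mdeg_mon7 // -ltnS.
apply: memv_suml => i _; have [->|i2] := eqVneq (i : nat) 2%N.
  by rewrite p2 scale0r mem0v.
have [->|i5] := eqVneq (i : nat) 5%N; first by rewrite p5 scale0r mem0v.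
apply/memvZ/memv_span/map_f; rewrite mpolyX_mon7 /lucas7_monomials !inE.
by case: i i2 i5 => /= -[|[|[|[|[|[|[|[|]]]]]]]] //= _ _ _;
  rewrite ?expr0 ?mul1r ?mulr1 ?eqxx ?orbT.
Qed.

Lemma lucas7_blocksE S : (S \in lucas7_blocks F)
  = [&& #|S| == 7%N, (FS S)@_(mon7 2) == 0 & (FS S)@_(mon7 5) == 0].
Proof.
rewrite inE; have [S7|//] := eqVneq #|S| 7%N.
by rewrite mem_W7Luc // -S7 FS_homog.
Qed.

End Membership.

(** * Invariance under affine maps and inversion, and transitivity on 3-subsets *)

Section Homogeneity.

Variable F : finFieldType.
Hypothesis F3 : 3%:R = 0 :> F.
Implicit Types (S T : {set P1 F}) (p : {mpoly F[2]}).

Definition dehom : {mpoly F[2]} -> {poly F} :=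
  mmap (@polyC F) (fun j : 'I_2 => if j == ord0 then 'X else 1).

Lemma dehom_homog7 p : p \is 7.-homog -> dehom p = \poly_(i < 8) p@_(mon7 i).
Proof.
move=> p7; rewrite {1}(homog7_expand p7) /dehom raddf_sum poly_def /=.
apply: eq_bigr => i _; rewrite mmapZ mmapX /mmap1 !big_ord_recl big_ord0 !mnmE /=.
by rewrite expr1n !mulr1 mul_polyC.
Qed.

Definition dehom_factor (t : P1 F) : {poly F} := if t is Some a then 'X - a%:P else 1.

Lemma dehom_FS S : dehom (FS S) = \prod_(t in S) dehom_factor t.
Proof.
rewrite /dehom rmorph_prod; apply: eq_bigr => -[a|] _ /=.
  by rewrite mmapB mmapZ !mmapX !mmap1U /= mulr1.
by rewrite mmapX mmap1U.
Qed.

(* In characteristic 3, i (i - 1) vanishes unless i = 2 mod 3. *)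
Lemma lucas7_blocks_deriv2 S :
  (S \in lucas7_blocks F) = (#|S| == 7%N) && ((dehom (FS S))^`()^`() == 0).
Proof.
rewrite lucas7_blocksE; have [S7|//] := eqVneq #|S| 7%N; rewrite /=.
have hS : FS S \is 7.-homog by rewrite -S7 FS_homog.
have n3 n : (3 %| n)%N -> n%:R = 0 :> F by case/dvdnP=> k ->; rewrite natrM F3 mulr0.
rewrite (dehom_homog7 hS); apply/andP/eqP => [[/eqP p2 /eqP p5]|/polyP d].
  apply/polyP => i; rewrite !coef_deriv coef_poly coef0.
  by case: i => [|[|[|[|[|[|i]]]]]] //=; rewrite ?p2 ?p5 ?mul0rn //;
    rewrite -mulrnA -mulr_natr n3 ?mulr0.
have := d 0%N; have := d 3%N; rewrite !coef_deriv !coef_poly !coef0 /= -!mulrnA.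
rewrite -[_ *+ (5 * 4)]mulr_natr -[_ *+ (2 * 1)]mulr_natr.
have -> : (5 * 4)%:R = 2%:R :> F by rewrite (natrD _ 18 2) n3 // add0r.
move=> /eqP p5 /eqP p2; move: p2 p5.
by rewrite !mulf_eq0 (negPf (two_neq0 F3)) !orbF.
Qed.

Definition affine (k c : F) : P1 F -> P1 F := omap (fun x => k * x + c).

Lemma affineK (k c : F) : k != 0 -> cancel (affine k c) (affine k^-1 (- (k^-1 * c))).
Proof. by move=> k0 [x|] //=; congr Some; field. Qed.

Lemma affineVK (k c : F) : k != 0 -> cancel (affine k^-1 (- (k^-1 * c))) (affine k c).
Proof. by move=> k0 [x|] //=; congr Some; field. Qed.

Lemma affine_inj (k c : F) : k != 0 -> injective (affine k c).
Proof. by move=> k0; apply: can_inj (affineK c k0). Qed.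

(** Substituting [L = k X + c] into the polynomial of the image gives a nonzero multiple of that of
    [S]. By the chain rule this passes to second derivatives, and substituting [L] annihilates no
    nonzero polynomial. *)
Lemma lucas7_blocks_affine (k c : F) S : k != 0 ->
  (affine k c @: S \in lucas7_blocks F) = (S \in lucas7_blocks F).
Proof.
move=> k0; have inj := @affine_inj k c k0.
rewrite !lucas7_blocks_deriv2 card_imset //; congr (_ && _).
pose L := k *: 'X + c%:P; pose C (t : P1 F) : F := if t is Some _ then k else 1.
have sL : size L = 2%N.
  by rewrite size_polyDl ?size_scale ?size_polyX // (leq_ltn_trans (size_polyC_leq1 _)).
have e : dehom (FS (affine k c @: S)) \Po L = (\prod_(t in S) C t) *: dehom (FS S).
  rewrite !dehom_FS big_imset /=; last by move=> ? ? _ _ /inj.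
  rewrite rmorph_prod -mul_polyC rmorph_prod -big_split /=.
  apply: eq_bigr => -[x|] _ /=; last by rewrite mul1r comp_polyC.
  rewrite comp_polyB comp_polyX comp_polyC /L -mul_polyC !polyCD !polyCM; ring.
have C0 : \prod_(t in S) C t != 0.
  by apply/prodf_neq0 => -[x|] _ //=; apply: oner_neq0.
have dL : L^`() = k%:P by rewrite derivD derivZ derivX derivC addr0 alg_polyC.
have := congr1 (fun P : {poly F} => P^`()^`()) e.
rewrite !derivZ deriv_comp dL derivM deriv_comp dL derivC mulr0 addr0 => e2.
rewrite -(comp_poly2_eq0 _ sL).
have -> : (((dehom (FS (affine k c @: S)))^`())^`() \Po L == 0)
    = (\prod_(t in S) C t *: ((dehom (FS S))^`())^`() == 0).
  by rewrite -e2 !mulf_eq0 !polyC_eq0 (negPf k0) !orbF.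
by rewrite scaler_eq0 (negPf C0).
Qed.

Definition inversion (t : P1 F) : P1 F :=
  if t is Some x then (if x == 0 then None else Some x^-1) else Some 0.

Lemma inversionK : involutive inversion.
Proof.
case=> [x|] /=; last by rewrite eqxx.
by have [->|x0] //= := eqVneq x 0; rewrite invr_eq0 (negPf x0) invrK.
Qed.

(** Exchanging the variables turns [X - x Y] into [- x (X - x^-1 Y)] for [x != 0] and exchanges the
    factors of [0] and infinity; it also swaps the two coefficients that have to vanish. *)
Lemma lucas7_blocks_inversion S :
  (inversion @: S \in lucas7_blocks F) = (S \in lucas7_blocks F).
Proof.
have inj := inv_inj inversionK.
rewrite !lucas7_blocksE card_imset //; congr (_ && _).
pose C (t : P1 F) : F := if t is Some x then (if x == 0 then 1 else - x) else 1.
pose sw := tperm (ord0 : 'I_2) ord_max.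
have mX (i : 'I_2) : msym sw ('X_i : {mpoly F[2]}) = 'X_(sw i).
  rewrite msymX; congr 'X_[_]; apply/mnmP => j; rewrite !mnmE.
  by rewrite -[in LHS](inj_eq (@perm_inj _ sw)) permKV.
have e : msym sw (FS S) = (\prod_(t in S) C t) *: FS (inversion @: S).
  rewrite /FS big_imset /=; last by move=> ? ? _ _ /inj.
  rewrite rmorph_prod -mul_mpolyC rmorph_prod -big_split /=.
  apply: eq_bigr => -[x|] _ /=.
    rewrite msymB msymZ !mX tpermL tpermR.
    have [->|x0] /= := eqVneq x 0; first by rewrite scale0r subr0 mul1r.
    rewrite -!mul_mpolyC mulrBr mulrA -mpolyCM mulNr mulfV // !mpolyCN /varX /varY; ring.
  by rewrite mX tpermR mul1r scale0r subr0.
have C0 : \prod_(t in S) C t != 0.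
  apply/prodf_neq0 => -[x|] _; rewrite /C; last exact: oner_neq0.
  by have [_|x0] := eqVneq x 0; rewrite ?oner_neq0 ?oppr_eq0.
have co i j : mon7 i = [multinom mon7 j (sw l) | l < 2] ->
    ((FS (inversion @: S))@_(mon7 j) == 0) = ((FS S)@_(mon7 i) == 0).
  by move=> ->; rewrite -mcoeff_sym e mcoeffZ mulf_eq0 (negPf C0).
have sw7 i : (i <= 7)%N -> mon7 (7 - i) = [multinom mon7 i (sw l) | l < 2].
  move=> i7; apply/mnmP => j; rewrite !mnmE.
  have [->|j0] := eqVneq j ord0; first by rewrite tpermL.
  have -> : j = ord_max by apply: val_inj; case: j j0 => -[|[]].
  by rewrite tpermR eqxx subKn.
by rewrite andbC (co 5 2 (sw7 2 isT))%N (co 2 5 (sw7 5 isT))%N.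
Qed.

Definition cover_count T := #|[set S in lucas7_blocks F | T \subset S]|.

Lemma cover_count_imset (g g' : P1 F -> P1 F) T :
    cancel g g' -> cancel g' g ->
    (forall S, (g @: S \in lucas7_blocks F) = (S \in lucas7_blocks F)) ->
  cover_count (g @: T) = cover_count T.
Proof.
move=> gK g'K; rewrite /cover_count; move: (lucas7_blocks F) => B gB.
have iK S : g @: (g' @: S) = S by rewrite -imset_comp (eq_imset _ g'K) imset_id.
have iK' S : g' @: (g @: S) = S by rewrite -imset_comp (eq_imset _ gK) imset_id.
apply: (@card_bij_in _ _ _ _ (fun S => g' @: S) (fun S => g @: S)) => S; rewrite ?inE.
- by case/andP=> SB TS; rewrite -gB iK SB -(iK' T) imsetS.
- by case/andP=> SB TS; rewrite gB SB imsetS.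
- by move=> _; apply: iK.
- by move=> _; apply: iK'.
Qed.

Lemma cover_count_affine k c T : k != 0 -> cover_count (affine k c @: T) = cover_count T.
Proof.
move=> k0; apply: (cover_count_imset _ (affineK c k0) (affineVK c k0)) => S.
exact: lucas7_blocks_affine.
Qed.

Lemma cover_count_inversion T : cover_count (inversion @: T) = cover_count T.
Proof. exact: (cover_count_imset _ inversionK inversionK) lucas7_blocks_inversion. Qed.

Let T0 : {set P1 F} := [set None; Some 0; Some 1].

Lemma cover_count_infty (x y : F) : x != y ->
  cover_count [set None; Some x; Some y] = cover_count T0.
Proof.
move=> xy; have yx : y - x != 0 by rewrite subr_eq0 eq_sym.
rewrite -(@cover_count_affine (y - x)^-1 (- ((y - x)^-1 * x))) ?invr_eq0 //.
congr cover_count; rewrite !imsetU !imset_set1 /= subrr -mulrBr mulVf //.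
Qed.

(** The map [t -> 1 / (t - x)] sends [x] to infinity and the other two points to finite ones. *)
Lemma cover_count_finite (x : F) (b c : P1 F) :
  uniq [:: Some x; b; c] -> cover_count [set Some x; b; c] = cover_count T0.
Proof.
pose g t := inversion (affine 1 (- x) t).
have ginj : injective g by exact: inj_comp (inv_inj inversionK) (@affine_inj 1 (- x) (oner_neq0 F)).
have gx : g (Some x) = None by rewrite /g /= mul1r subrr eqxx.
rewrite /= !inE negb_or andbT => /andP[/andP[xb xc] bc].
rewrite -(@cover_count_affine 1 (- x)) ?oner_neq0 // -cover_count_inversion.
rewrite !imsetU !imset_set1 -/(g (Some x)) -/(g b) -/(g c) gx.
have gb : g b != None by rewrite -gx (inj_eq ginj) eq_sym.
have gc : g c != None by rewrite -gx (inj_eq ginj) eq_sym.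
have gbc : g b != g c by rewrite (inj_eq ginj).
by case: (g b) (g c) gb gc gbc => [u|] [v|] // _ _ uv; apply: cover_count_infty.
Qed.

Lemma cover_count3 T : #|T| = 3%N -> cover_count T = cover_count T0.
Proof.
move=> T3; have := enum_uniq T; have := mem_enum T; rewrite cardE in T3.
case: (enum T) T3 => [|a [|b [|c []]]] // _ eT uT.
have -> : T = [set a; b; c] by apply/setP => t; rewrite -eT !inE orbA.
(* At most one point is infinity, so [a] or [b] is finite and can be listed first. *)
case: a b uT {eT} => [x|] [y|] //= uT; first exact: cover_count_finite.
  exact: cover_count_finite.
rewrite [[set None; _]]setUC; apply: cover_count_finite.
by move: uT; rewrite /= !inE !negb_or !andbT => /andP[/andP[_ ->] ->].
Qed.

End Homogeneity.

(** * The number of blocks *)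

Section BaseCount.

Variable F : finFieldType.
Hypothesis F3 : 3%:R = 0 :> F.
Implicit Types (S : {set P1 F}) (t : F * F * F * F).

Let T0 : {set P1 F} := [set None; Some 0; Some 1].

Definition quad_seq t : seq F := let: (x1, x2, x3, x4) := t in [:: x1; x2; x3; x4].

Definition quad_points t : seq (P1 F) := None :: map Some (0 :: 1 :: quad_seq t).

Definition quad_block t : {set P1 F} := [set z in quad_points t].

Lemma quad_points_uniq t : uniq (quad_points t) = uniq (0 :: 1 :: quad_seq t).
Proof.
rewrite /quad_points cons_uniq map_inj_uniq; last by move=> x y [].
by rewrite (_ : None \notin _) //; apply/mapP=> -[].
Qed.

(** This is the dehomogenised form of the block, of degree 6 because infinity contributes the factor
    [1]. The two coefficients are, up to sign, the equations of [completions]. *)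
Lemma coefs_sextic (x1 x2 x3 x4 : F) :
  let P := ('X - 0%:P) * (('X - 1%:P) * (('X - x1%:P) * (('X - x2%:P)
             * (('X - x3%:P) * ('X - x4%:P))))) in
  P`_5 = - (x1 + x2 + x3 + x4 + 1) /\ P`_2 = esym3 x1 x2 x3 x4 + x1 * x2 * x3 * x4.
Proof.
move=> P.
(* From [c5] down to [c1]: the elementary symmetric functions of degrees 1 to 5 of [1], [x1], ..,
   [x4]. *)
pose c5 := x1 + x2 + x3 + x4 + 1; pose c2 := esym3 x1 x2 x3 x4 + x1 * x2 * x3 * x4.
pose e2 := x1 * x2 + x1 * x3 + x1 * x4 + x2 * x3 + x2 * x4 + x3 * x4.
pose c4 := e2 + (x1 + x2 + x3 + x4); pose c3 := esym3 x1 x2 x3 x4 + e2.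
pose c1 := x1 * x2 * x3 * x4.
have -> : P = 'X^6 - c5%:P * 'X^5 + c4%:P * 'X^4 - c3%:P * 'X^3 + c2%:P * 'X^2 - c1%:P * 'X^1.
  rewrite /P /c5 /c4 /c3 /c2 /c1 /e2 /esym3 !(polyCD, polyCM) polyC0 polyC1; ring.
split; rewrite !(coefB, coefD, coefCM, coefXn) /=; rewrite /c5 /c2; ring.
Qed.

Lemma quad_blockE t : uniq (0 :: 1 :: quad_seq t) ->
  (quad_block t \in lucas7_blocks F) = (t \in completions F).
Proof.
move=> ut; have ut' : uniq (quad_points t) by rewrite quad_points_uniq.
have c7 : #|quad_block t| = 7%N.
  by rewrite cardsE (card_uniqP ut') /= size_map; case: t {ut ut'} => -[[]].
have hS : FS (quad_block t) \is 7.-homog by rewrite -c7 FS_homog.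
rewrite lucas7_blocksE c7 eqxx /=.
have co i : (i < 8)%N -> (FS (quad_block t))@_(mon7 i) = (dehom (FS (quad_block t)))`_i.
  by move=> i8; rewrite dehom_homog7 // coef_poly i8.
rewrite !co // dehom_FS /quad_block.
rewrite (eq_bigl (mem (quad_points t))) => [|z]; last by rewrite inE.
rewrite -big_uniq //.
case: t {c7 hS co ut'} ut => -[[x1 x2] x3] x4 ut.
rewrite /quad_points [map _ _]/= !big_cons big_nil /= mul1r mulr1.
have [-> ->] := coefs_sextic x1 x2 x3 x4.
by rewrite inE ut oppr_eq0 andbC.
Qed.

Lemma completions_uniq t : t \in completions F -> uniq (0 :: 1 :: quad_seq t).
Proof. by case: t => -[[x1 x2] x3] x4; rewrite inE => /and3P[]. Qed.

Lemma base_sub_quad_block t : T0 \subset quad_block t.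
Proof.
apply/subsetP=> z; rewrite !inE -orbA => /or3P[] /eqP-> //;
  by rewrite eqxx ?orbT.
Qed.

(** The fibre consists of the [4!] orderings of the four points of [S] outside [T0]. *)
Lemma card_quad_fibre S : S \in lucas7_blocks F -> T0 \subset S ->
  #|[set t in completions F | quad_block t == S]| = 24%N.
Proof.
move=> SB T0S; have S7 : #|S| = 7%N.
  by move: SB; rewrite lucas7_blocksE => /andP[/eqP].
pose A := [set x | Some x \in S :\: T0].
have A4 : #|A| = 4%N.
  have -> : #|A| = #|S :\: T0|.
    rewrite -(card_imset A (@Some_inj _)); congr #|pred_of_set _|; apply/setP => -[x|].
      by rewrite mem_imset ?inE //; apply: Some_inj.
    by rewrite !inE eqxx; apply/imsetP=> -[].
  rewrite cardsDS // S7 /T0 -setUA cardsU1 cards2 !inE /=.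
  by rewrite (inj_eq (@Some_inj _)) eq_sym oner_eq0.
rewrite -[RHS]/(4 ^_ 4)%N -{1}A4 -card_uniq_tuples.
pose f t : 4.-tuple F := let: (x1, x2, x3, x4) := t in [tuple x1; x2; x3; x4].
pose g (s : 4.-tuple F) : F * F * F * F :=
  (tnth s (inord 0), tnth s (inord 1), tnth s (inord 2), tnth s (inord 3)).
have fK : cancel f g.
  by case=> -[[x1 x2] x3] x4; rewrite /f /g !(tnth_nth 0) !inordK.
have gK : cancel g f.
  case=> -[|x1 [|x2 [|x3 [|x4 []]]]] //= sz; apply: val_inj.
  by rewrite /= !(tnth_nth 0) !inordK.
have fE t : f t = quad_seq t :> seq F by case: t => -[[]].
have key t : (t \in completions F) && (quad_block t == S) = all (mem A) (f t) && uniq (f t).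
  rewrite fE; apply/andP/andP=> [[tC /eqP tS]|[tA tu]].
    have := completions_uniq tC; rewrite !cons_uniq inE negb_or => /and3P[/andP[_ t0] t1 ->].
    split=> //; apply/allP => x xt; rewrite !inE -tS !inE /= map_f ?orbT // ?inE ?xt ?orbT //.
    rewrite andbT !(inj_eq (@Some_inj _)) negb_or.
    by apply/andP; split; [apply: contraNneq t0 => <- | apply: contraNneq t1 => <-].
  have nA x : x \in quad_seq t -> [&& Some x \in S, x != 0 & x != 1].
    move/(allP tA); rewrite !inE negb_or !(inj_eq (@Some_inj _)).
    by case/andP=> /andP[-> ->] ->.
  have ut : uniq (0 :: 1 :: quad_seq t).
    rewrite !cons_uniq inE eq_sym oner_eq0 tu andbT /=; apply/andP; split.
      by apply/negP=> /nA; rewrite eqxx andbF.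
    by apply/negP=> /nA; rewrite eqxx !andbF.
  have tS : quad_block t = S.
    apply/eqP; rewrite eqEcard; apply/andP; split; last first.
      rewrite S7 cardsE (card_uniqP _) ?quad_points_uniq //= size_map.
      by case: t {tA tu nA ut} => -[[]].
    apply/subsetP => z; rewrite inE /quad_points inE => /orP[/eqP->|].
      by apply: (subsetP T0S); rewrite !inE.
    case/mapP => x + ->; rewrite !inE => /or3P[/eqP->|/eqP->|/nA/and3P[] //].
      by apply: (subsetP T0S); rewrite !inE eqxx orbT.
    by apply: (subsetP T0S); rewrite !inE eqxx orbT.
  by rewrite -quad_blockE // tS SB eqxx.
apply: (@card_bij_in _ _ _ _ f g) => [t|s|t _|s _]; last 2 first.
- exact: fK.
- exact: gK.
- move=> tF; have h : (t \in completions F) && (quad_block t == S) by move: tF; rewrite in_set.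
  by rewrite key in h; rewrite in_set; exact: h.
- move=> sA; have h : all (mem A) s && uniq s by move: sA; rewrite in_set.
  by rewrite in_set key gK.
Qed.

Lemma card_completions_cover : #|completions F| = (24 * cover_count T0)%N.
Proof.
pose covers S := (S \in lucas7_blocks F) && (T0 \subset S).
rewrite -sum1_card (partition_big quad_block covers) /=.
  rewrite /cover_count -sum1dep_card big_distrr /=; apply: eq_bigr => S /andP[SB T0S].
  by rewrite -[RHS](card_quad_fibre SB T0S) sum1dep_card.
by move=> t tC; rewrite /covers quad_blockE ?completions_uniq // tC base_sub_quad_block.
Qed.

End BaseCount.

(** * Double counting and the sign of [chi (-1)] *)

Lemma expn3_mod8 m : (3 ^ m %% 8 = if odd m then 3 else 1)%N.
Proof.
elim: m => [|m IH] //; rewrite expnS -modnMmr IH /=.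
by case: (odd m).
Qed.

(** Pairs of a 3-subset and a block containing it are counted in both orders; a block has
    [35 = 'C(7, 3)] such subsets. *)
Lemma double_count_blocks (F : finFieldType) (lam : nat) :
    (forall T : {set P1 F}, #|T| = 3%N -> cover_count T = lam) ->
  ('C(#|F|.+1, 3) * lam = 35 * #|lucas7_blocks F|)%N.
Proof.
move=> lamE.
transitivity (\sum_(T : {set P1 F} | #|T| == 3%N) \sum_(S in lucas7_blocks F) (T \subset S))%N.
  rewrite -card_option -(card_draws (P1 F)) -sum_nat_const big_mkcond [RHS]big_mkcond /=.
  apply: eq_bigr => T _; rewrite inE; case: eqP => // /lamE <-.
  rewrite /cover_count -sum1dep_card big_mkcondr /=.
  by apply: eq_bigr => S _; case: (T \subset S).
rewrite exchange_big /= mulnC -sum_nat_const; apply: eq_bigr => S.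
rewrite lucas7_blocksE => /andP[/eqP S7 _].
have -> : 35%N = #|[set T : {set P1 F} | T \subset S & #|T| == 3%N]|.
  by rewrite cards_draws S7.
rewrite -sum1dep_card [RHS]big_mkcondl big_mkcond [RHS]big_mkcond /=.
by apply: eq_bigr => T _; case: (T \subset S); case: (_ == _).
Qed.

(** Modulo 8 the right-hand side is [chi (-1) - 1] for even [m] and [3 (chi (-1) + 1)] for odd [m];
    divisibility by 8 leaves one sign. *)
Lemma chi_N1_pow (F : finFieldType) (m lam : nat) :
    3%:R = 0 :> F -> #|F| = (3 ^ m)%N ->
    (24 * lam)%:R = #|F|%:R ^+ 2 + (chi (-1%R : F) - 14) * #|F|%:R + 36 :> int ->
  chi (-1 : F) = (-1) ^+ m.
Proof.
move=> F3 Fm; rewrite -signr_odd.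
have N10 : -1 != 0 :> F by rewrite oppr_eq0 oner_eq0.
have := expn3_mod8 m; rewrite -Fm; move: #|F| => q qm.
rewrite (divn_eq q 8) qm; move: (q %/ 8)%N => k {qm Fm}.
by case: (chi_sign (two_neq0 F3) N10) => ->; case: (odd m) => /=; nia.
Qed.

Theorem theorem4 (F : finFieldType) (m q : nat)
    (hm : (1 <= m)%N) (hq : q = (3 ^ m)%N) (hF : #|F| = q) :
  exists lambda2 : nat,
    (forall T : {set P1 F}, #|T| = 3%N ->
       #|[set S in lucas7_blocks F | T \subset S]| = lambda2) /\
    lambda2%:R = (q%:R ^+ 2 + ((-1) ^+ m - 14) * q%:R + 36) / 24 :> rat /\
    #|lucas7_blocks F|%:R
      = q%:R * (q%:R ^+ 2 - 1) * (q%:R ^+ 2 + ((-1) ^+ m - 14) * q%:R + 36)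
        / 5040 :> rat /\
    (lucas7_blocks F <> set0 <-> (0 < lambda2)%N) /\
    ((0 < lambda2)%N <-> (3 <= m)%N) /\
    ((3 <= m)%N -> is_design 3 (q + 1) 7 lambda2 (lucas7_blocks F)).
Proof.
have F3 : 3%:R = 0 :> F.
  by apply: pcharf0; apply: (@card_finPcharP _ _ m); rewrite ?hF.
pose lam := cover_count [set None; Some (0 : F); Some 1].
have lamE (T : {set P1 F}) : #|T| = 3%N -> cover_count T = lam by exact: cover_count3.
have lam24 : (24 * lam)%:R = q%:R ^+ 2 + ((-1) ^+ m - 14) * q%:R + 36 :> int.
  have e : (24 * lam)%:R = #|F|%:R ^+ 2 + (chi (-1%R : F) - 14) * #|F|%:R + 36 :> int.
    by rewrite -card_completions // card_completions_cover.
  by rewrite e (chi_N1_pow F3 (etrans hF hq) e) hF.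
have dc := double_count_blocks lamE.
have q3 : (3 <= q)%N by rewrite hq -{1}(expn1 3) leq_exp2l.
have lamQ : 24 * lam%:R = q%:R ^+ 2 + ((-1) ^+ m - 14) * q%:R + 36 :> rat.
  have := congr1 (fun z : int => z%:~R : rat) lam24.
  by rewrite !(rmorphD, rmorphM, rmorphB, rmorphXn, rmorphN1, rmorph_nat, natrM) /=.
(* The quadratic is [(q - 3) (q - 12)] for odd [m] and [(q - 4) (q - 9)] for even [m]: it vanishes
   at [q = 3] and [q = 9] respectively, and is positive from [q = 27] on. *)
have lam_pos : (0 < lam)%N <-> (3 <= m)%N.
  split=> [lam0|m3].
    rewrite leqNgt; apply/negP => m3; move: lam24 lam0.
    by rewrite hq; case: (m) hm m3 => [|[|[|]]] //= _ _; lia.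
  have q27 : (27 <= q)%N by rewrite hq (leq_pexp2l _ m3 : 3 ^ 3 <= _)%N.
  have := lam24; rewrite -signr_odd; case: (odd m) => /=; nia.
exists lam; split; first exact: lamE.
split; first by rewrite -lamQ mulrC mulKf.
split.
  have e6 : ('C(q.+1, 3) * 6 = q.+1 * (q * q.-1))%N.
    by rewrite (bin_ffact _ 3) !ffactnS ffactn0 muln1.
  have q1 : q.-1%:R = q%:R - 1 :> rat by rewrite -subn1 natrB //; lia.
  have := congr1 (fun n => (n * 6)%:R : rat) dc; rewrite hF mulnAC e6 !natrM q1 -(addn1 q) natrD.
  (* [210 = 35 * 6], with [35] from the double count and [6] from the binomial coefficient, and
     [5040 = 24 * 210]. *)
  rewrite -lamQ => e; apply: (mulIf (_ : 210 != 0 :> rat)) => //.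
  transitivity (35 * #|lucas7_blocks F|%:R * 6 : rat); first by ring.
  by rewrite -e; field.
split.
  have C0 : (0 < 'C(q.+1, 3))%N by rewrite bin_gt0; lia.
  split=> [/eqP B0|lam0 B0]; last first.
    by move: dc; rewrite B0 cards0 hF muln0 => /eqP; rewrite muln_eq0; lia.
  have : (0 < #|lucas7_blocks F|)%N by rewrite card_gt0.
  by rewrite lt0n; move: dc; rewrite hF; case: (posnP lam) => // ->; lia.
split=> // m3; split.
- by rewrite card_option hF addn1.
- by move=> S; rewrite lucas7_blocksE => /andP[/eqP].
- exact: lamE.
Qed.
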